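(* For every $\alpha>1$, the measure metric space $(\mathfrak X,\rho,\sigma_\alpha)$ is doubling with doubling constant $$k_\alpha=\max\Bigl\{q^\alpha,\frac1{1-q^{1-\alpha}}\Bigr\},$$ that is, $\sigma_\alpha(B_\rho(x,2r))\le k_\alpha\,\sigma_\alpha(B_\rho(x,r))$ for all $x\in\mathfrak X$ and $r>0$.
   Context: Let $q\ge 2$ be an integer and let $\mathfrak X$ be (the vertex set of) the $q$-homogeneous tree: the connected graph without cycles in which every vertex has exactly $q+1$ neighbours ($x\sim y$ means $x,y$ are neighbours); $d$ is the edge-counting distance, $\mathbb N=\{0,1,2,\dots\}$. An infinite chain is a sequence $(x_i)_{i\in\mathbb N}$ with $x_i\sim x_{i+1}$ and $x_i\ne x_{i+2}$; two infinite chains $(x_i),(y_j)$ are equivalent if for some $m\in\mathbb Z$ one has $x_i=y_{i+m}$ eventually; a boundary point is an equivalence class. Fix a boundary point $\omega$. For $x\in\mathfrak X$, $[x,\omega)$ is the infinite chain starting at $x$ in the class $\omega$ and $x\wedge y$ is the vertex $z$ with $[x,\omega)\cap[y,\omega)=[z,\omega)$. Vertices $x,y$ lie on the same horocycle if $d(x,x\wedge y)=d(y,x\wedge y)$. Fix a horocycle $H_0$ and, for $k\in\mathbb Z$, let $H_k=\{x: d(x,x\wedge y)=d(y,x\wedge y)+k \text{ for some } y\in H_0\}$; the $H_k$ partition $\mathfrak X$. The horocyclic index $h(x)$ is the integer with $x\in H_{h(x)}$. For $\alpha>1$, $\sigma_\alpha$ is the measure on $\mathfrak X$ with $\sigma_\alpha(x)=q^{-\alpha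 h(x)}$. The horocyclic Gromov distance is $\rho(x,y)=0$ if $x=y$ and $\rho(x,y)=e^{-h(x\wedge y)}$ if $x\ne y$; balls are closed: $B_\rho(x,r)=\{y\in\mathfrak X:\rho(x,y)\le r\}$. A measure metric space $(X,\delta,\mu)$ is doubling if there is $C>0$ (a doubling constant) with $\mu(B(x,2r))\le C\mu(B(x,r))$ for all $x\in X$, $r>0$. *)

(* Defs.v *)
From HB Require Import structures.
From mathcomp Require Export all_boot all_order all_algebra.
From mathcomp Require Export all_classical all_reals all_analysis.

Set Implicit Arguments.
Unset Strict Implicit.
Unset Printing Implicit Defensive.

Import Order.TTheory GRing.Theory Num.Theory.
Local Open Scope classical_set_scope.
Local Open Scope ring_scope.

(* [path] and [ucycle] are those of the MathComp library [path]; a cycle of the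
   graph is a duplicate-free closed path of length at least 3. *)
Record homogeneous_tree (q : nat) (V : choiceType) (adj : rel V) : Prop :=
  HomogeneousTree {
    adj_sym : symmetric adj ;
    adj_irr : irreflexive adj ;
    adj_connected : forall x y : V, exists2 p : seq V, path adj x p & last x p = y ;
    adj_acyclic : forall c : seq V, (2 < size c)%N -> ~ ucycle adj c ;
    adj_degree : forall x : V, ([set y | adj x y] #= `I_q.+1)%card
  }.

Definition walk_length (V : choiceType) (adj : rel V) (x y : V) : set nat :=
  [set n | exists p : seq V, [/\ path adj x p, last x p = y & size p = n]].

Definition dist (V : choiceType) (adj : rel V) (x y : V) : nat :=
  xget 0%N [set n | walk_length adj x y n /\
                    forall m, walk_length adj x y m -> (n <= m)%N].

Definition infinite_chain (V : choiceType) (adj : rel V) (c : nat -> V) : Prop :=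
  forall i, adj (c i) (c i.+1) /\ c i != c i.+2.

(* For [m < 0] the index [i + m] is a natural number only for large [i]. *)
Definition chain_equiv (V : choiceType) (c c' : nat -> V) : Prop :=
  exists m : int, \forall i \near \oo,
    exists2 j : nat, j%:Z = i%:Z + m & c i = c' j.

Definition boundary_point (V : choiceType) (adj : rel V)
    (omega : set (nat -> V)) : Prop :=
  exists2 c, infinite_chain adj c &
    omega = [set c' | infinite_chain adj c' /\ chain_equiv c c'].

(* In a homogeneous tree exactly one chain of [omega] starts at [x]. *)
Definition ray (V : choiceType) (omega : set (nat -> V)) (x : V) : nat -> V :=
  xget (fun=> x) [set c | omega c /\ c 0%N = x].

Definition meet (V : choiceType) (omega : set (nat -> V)) (x y : V) : V :=
  xget x [set z | range (ray omega x) `&` range (ray omega y)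
                  = range (ray omega z)].

Definition same_horocycle (V : choiceType) (adj : rel V)
    (omega : set (nat -> V)) (x y : V) : Prop :=
  dist adj x (meet omega x y) = dist adj y (meet omega x y).

Definition is_horocycle (V : choiceType) (adj : rel V)
    (omega : set (nat -> V)) (H : set V) : Prop :=
  exists x : V, H = [set y | same_horocycle adj omega x y].

Definition horocycle (V : choiceType) (adj : rel V)
    (omega : set (nat -> V)) (H0 : set V) (k : int) : set V :=
  [set x | exists2 y, H0 y &
     (dist adj x (meet omega x y))%:Z = (dist adj y (meet omega x y))%:Z + k].

(* The sets [horocycle adj omega H0 k], k in Z, partition the tree. *)
Definition horo_index (V : choiceType) (adj : rel V)
    (omega : set (nat -> V)) (H0 : set V) (x : V) : int :=
  xget 0 [set k | horocycle adj omega H0 k x].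

Definition horo_rho (R : realType) (V : choiceType) (adj : rel V)
    (omega : set (nat -> V)) (H0 : set V) (x y : V) : R :=
  if x == y then 0
  else expR (- (horo_index adj omega H0 (meet omega x y))%:~R).

(* [V] equipped with the sigma-algebra of all its subsets; the base point
   required by [measurableType] plays no role. *)
Definition discrete (V : Type) : Type := V.

Section discrete_measurable_structure.
Variable V : pointedType.
HB.instance Definition _ := Pointed.on (discrete V).
HB.instance Definition _ := @isMeasurable.Build default_measure_display
  (discrete V) discrete_measurable discrete_measurable0
  discrete_measurableC discrete_measurableU.
End discrete_measurable_structure.

Definition sigma_weight (R : realType) (q : nat) (V : choiceType)
    (adj : rel V) (omega : set (nat -> V)) (H0 : set V) (alpha : R)
    (x : V) : R :=
  q%:R `^ (- (alpha * (horo_index adj omega H0 x)%:~R)).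

Definition sigma (R : realType) (q : nat) (V : pointedType) (adj : rel V)
    (omega : set (nat -> V)) (H0 : set V) (alpha : R)
    (A : set (discrete V)) : \bar R :=
  \esum_(x in A) (sigma_weight q adj omega H0 alpha x)%:E.

Section sigma_measure.
Variables (R : realType) (q : nat) (V : pointedType) (adj : rel V).
Variables (omega : set (nat -> V)) (H0 : set V) (alpha : R).
Local Notation sigma := (@sigma R q V adj omega H0 alpha).

Let sigma0 : sigma set0 = 0%E. Proof. exact: esum_set0. Qed.

Let sigma_ge0 A : (0 <= sigma A)%E.
Proof. by apply: esum_ge0 => x _; rewrite lee_fin powR_ge0. Qed.

Let sigma_sigma_additive : semi_sigma_additive sigma.
Proof.
move=> F _ tF _; rewrite /sigma nneseries_sum_bigcup //; last first.
  by move=> x; rewrite lee_fin powR_ge0.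
apply: is_cvg_nneseries => n _ _; exact: sigma_ge0.
Qed.

HB.instance Definition _ := isMeasure.Build _ _ _ sigma
  sigma0 sigma_ge0 sigma_sigma_additive.
End sigma_measure.

Definition closed_ball_of (R : realType) (X : Type) (delta : X -> X -> R)
    (x : X) (r : R) : set X := [set y | delta x y <= r].

Definition doubling_constant (R : realType) (d : measure_display)
    (X : measurableType d)
    (delta : X -> X -> R) (mu : {measure set X -> \bar R}) (C : R) : Prop :=
  0 < C /\ forall (x : X) (r : R), 0 < r ->
    (mu (closed_ball_of delta x (2 * r))
       <= C%:E * mu (closed_ball_of delta x r))%E.

Definition k_const (R : realType) (q : nat) (alpha : R) : R :=
  Num.max (q%:R `^ alpha) (1 - q%:R `^ (1 - alpha))^-1.

(* Main.v *)
Require Import Defs.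
From mathcomp Require Import finmap zify lra.

(** Fix the end [omega].  Acyclicity makes every infinite chain injective, and
    splicing two equivalent chains with the same origin into one chain then
    shows that each vertex starts exactly one chain of [omega]
    ([omega_from], [omega_uniq]).  The second vertex of that chain is the
    parent of [x]: the tree hangs from [omega], each vertex has one parent and
    [q] children ([adj_parentE], [card_children]), and any two vertices have a
    common ancestor, the lowest one being their meet ([ancestors_meet]).  The
    horocyclic index is a Busemann function, which drops by one along each
    edge to the parent ([horo_indexE], [busemann_iter]).

    Let [n] be the ceiling of [- ln r].  Since [horo_rho x y <= r] means
    [y = x] or [n <= h (meet x y)], the ball of centre [x] and radius [r] is
    the singleton [x] when [h x < n], and otherwise the set of descendants of
    the ancestor of [x] at level [n] ([closed_ball_horo_rho]).

    Put [s = q^-alpha].  A vertex [z] has [q^k] descendants of depth [k], each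
    of weight [s^k w(z)], so they have total mass [w(z) / (1 - q s)], where
    [q s = q^(1 - alpha) < 1] ([esum_subtree]).  As [ln 2 <= 1], doubling the
    radius lowers [n] by at most one ([ceil_ln_double]).  Hence a ball either
    does not change, or grows from the singleton [x] to all descendants of
    [x], with ratio [1 / (1 - q s)], or grows from the descendants of [z] to
    those of its parent, with ratio [q^alpha].  The constant is the maximum of
    these ratios, and [q^alpha >= 1] covers the first case. *)

Set Implicit Arguments.
Unset Strict Implicit.
Unset Printing Implicit Defensive.

Import Order.TTheory GRing.Theory Num.Theory.
Local Open Scope classical_set_scope.
Local Open Scope ring_scope.

(** * Infinite chains in a graph without cycles *)

Section InfiniteChains.
Variables (V : choiceType) (adj : rel V).
Hypothesis adj_symm : symmetric adj.
Hypothesis adj_irrefl : irreflexive adj.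
Hypothesis acyclic : forall c : seq V, (2 < size c)%N -> ~ ucycle adj c.

Implicit Types c d : nat -> V.

(** A repetition [c i = c (i + j)] with [j] least closes up to a cycle without
    repeated vertices: irreflexivity excludes [j = 1] and the absence of
    backtracking excludes [j = 2]. *)
Lemma infinite_chain_inj c : infinite_chain adj c -> injective c.
Proof.
move=> chain_c.
have neq j i : (0 < j)%N -> c i <> c (i + j)%N.
  elim/ltn_ind: j i => j IH i j_gt0 eq_c.
  pose s := mkseq (fun k => c (i + k)%N) j.
  have uniq_s : uniq s.
    apply/mkseq_uniqP => a b; rewrite !inE => a_lt b_lt.
    wlog le_ab : a b a_lt b_lt / (a <= b)%N.
      move=> W; case/orP: (leq_total a b) => [|le /esym eq_ab]; first exact: W.
      by apply/esym; exact: W.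
    case: (ltngtP a b) le_ab => // lt_ab _ eq_ab.
    case: (IH (b - a)%N _ (i + a)%N); [lia | lia |].
    by rewrite eq_ab; congr c; lia.
  have size_s : size s = j by rewrite size_mkseq.
  case: (ltngtP j 2) => [lt2|gt2|eq2].
  - have j1 : j = 1%N by lia.
    have [+ _] := chain_c i.
    by rewrite eq_c j1 addn1 adj_irrefl.
  - apply: (@acyclic s); first by rewrite size_s.
    rewrite /ucycle uniq_s andbT.
    have : sorted adj (rcons s (c (i + j)%N)).
      rewrite -mkseqS; apply/(sortedP (c 0%N)) => k; rewrite size_mkseq => lt_k.
      by rewrite !nth_mkseq//; [rewrite addnS; case: (chain_c (i + k)%N) | lia].
    rewrite -eq_c /s; case: (j) j_gt0 => // n _.
    by rewrite -[n.+1]add1n /mkseq iotaD /= addn0.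
  - have [_] := chain_c i.
    by rewrite eq_c eq2 addn2 eqxx.
move=> a b eq_ab.
wlog lt_ab : a b eq_ab / (a < b)%N.
  by case: (ltngtP a b) => // lt W; [exact: W | apply/esym; exact: W].
case: (@neq (b - a)%N a); first by lia.
by rewrite eq_ab; congr c; lia.
Qed.

Lemma infinite_chain_shift k c :
  infinite_chain adj c -> infinite_chain adj (fun n => c (k + n)%N).
Proof.
by move=> chain_c i; have [] := chain_c (k + i)%N; rewrite !addnS.
Qed.

Lemma infinite_chain_cons y c : adj y (c 0%N) -> y != c 1%N ->
  infinite_chain adj c ->
  infinite_chain adj (fun n => if n is n'.+1 then c n' else y).
Proof. by move=> adj_y neq_y chain_c [|i]; [split | exact: chain_c]. Qed.

(** Replaces the integer shift by two natural offsets, which compose well. *)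
Lemma chain_equivP c c' :
  chain_equiv c c' <-> exists a b, forall n, c (a + n)%N = c' (b + n)%N.
Proof.
split.
  case=> m [N _ NP].
  exists (N + `|m|)%N, (absz ((N + `|m|)%:Z + m)) => n.
  have [|j jE ->] := NP (N + `|m| + n)%N; first by rewrite /=; lia.
  by congr c'; lia.
case=> a [b eq_cc']; exists (b%:Z - a%:Z); exists a => // i /= le_ai.
exists (b + (i - a))%N; first by lia.
by rewrite -eq_cc'; congr c; lia.
Qed.

(** If the chains parted at their common origin, walking back along [c] from
    [c a] and then forward along [c'] would be an infinite chain, and it visits
    [c a = c' b] at the times [0] and [a + b].  So [a = b = 0], and then the
    chains agree from the start. *)
Lemma eq_chain1 c c' a b : infinite_chain adj c -> infinite_chain adj c' ->
  c 0%N = c' 0%N -> (forall n, c (a + n)%N = c' (b + n)%N) -> c 1%N = c' 1%N.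
Proof.
move=> chain_c chain_c' eq0 eq_tail.
have [//|neq1] := eqVneq (c 1%N) (c' 1%N).
(* [g] follows [c] backwards from [c a] to the origin, then [c'] forwards. *)
pose g i := if (i <= a)%N then c (a - i)%N else c' (i - a)%N.
have chain_g : infinite_chain adj g.
  move=> i; rewrite /g; case: (ltngtP i a) => [lt_ia|gt_ia|->].
  - split.
      have -> : (a - i)%N = (a - i.+1).+1 by lia.
      by rewrite adj_symm; have [] := chain_c (a - i.+1)%N.
    case: (ltngtP i.+1 a) => [lt_i1a|/ltac:(lia)|eq_a].
      have -> : (a - i)%N = (a - i.+2).+2 by lia.
      by rewrite eq_sym; have [] := chain_c (a - i.+2)%N.
    have -> : (a - i)%N = 1%N by lia.
    by have -> : (i.+2 - a)%N = 1%N by lia.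
  - have -> : (i.+2 <= a)%N = false by lia.
    have -> : (i.+1 - a)%N = (i - a).+1 by lia.
    have -> : (i.+2 - a)%N = (i - a).+2 by lia.
    exact: chain_c'.
  - have -> : (a.+2 <= a)%N = false by lia.
    have -> : (a.+1 - a)%N = 1%N by lia.
    have -> : (a.+2 - a)%N = 2%N by lia.
    by rewrite subnn eq0; exact: chain_c'.
have g0 : g 0%N = g (a + b)%N.
  rewrite /g subn0 -[a in LHS]addn0 eq_tail addn0.
  case: leqP => [le|_]; last by congr c'; lia.
  have -> : b = 0%N by lia.
  by rewrite addn0 subnn eq0.
have := infinite_chain_inj chain_g g0.
by case: a b eq_tail {g chain_g g0} => [|a] [|b] // eq_tail _;
  apply: (eq_tail 1%N).
Qed.

Lemma chain_equiv_inj c c' : infinite_chain adj c -> infinite_chain adj c' ->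
  c 0%N = c' 0%N -> chain_equiv c c' -> c = c'.
Proof.
move=> chain_c chain_c' eq0 /chain_equivP[a [b eq_tail]].
apply/funext => k.
elim: k c c' chain_c chain_c' eq0 eq_tail => // k IH c c' chain_c chain_c'.
move=> eq0 eq_tail.
have eq1 := eq_chain1 chain_c chain_c' eq0 eq_tail.
apply: (IH (fun n => c (1 + n)%N) (fun n => c' (1 + n)%N)) => // n.
by rewrite !(addnCA 1%N) eq_tail.
Qed.

End InfiniteChains.

(** * Parents and horofunction of a boundary point *)

Section Horofunction.
Variables (q : nat) (V : choiceType) (adj : rel V) (omega : set (nat -> V)).
Hypothesis tree : homogeneous_tree q adj.
Hypothesis boundary : boundary_point adj omega.

Let adj_symm : symmetric adj := adj_sym tree.
Let adj_irrefl : irreflexive adj := adj_irr tree.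

Lemma omega_chain c : omega c -> infinite_chain adj c.
Proof. by case: boundary => c0 _ -> []. Qed.

Lemma omega_equiv c a d b : omega c -> infinite_chain adj d ->
  (forall n, c (a + n)%N = d (b + n)%N) -> omega d.
Proof.
case: boundary => c0 _ -> [_ /chain_equivP[i [j eq_ij]]] chain_d eq_ab.
split=> //; apply/chain_equivP; exists (i + a)%N, (j + b)%N => n.
have -> : (i + a + n = i + (a + n))%N by lia.
rewrite eq_ij; have -> : (j + (a + n) = a + (j + n))%N by lia.
by rewrite eq_ab; congr d; lia.
Qed.

Lemma omega_common_tail c d : omega c -> omega d ->
  exists a b, forall n, c (a + n)%N = d (b + n)%N.
Proof.
case: boundary => c0 _ -> [_ /chain_equivP[i [j eq_ij]]].
case=> _ /chain_equivP[k [l eq_kl]]; exists (j + k)%N, (l + i)%N => n.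
rewrite -addnA -eq_ij; have -> : (i + (k + n) = k + (i + n))%N by lia.
by rewrite eq_kl; congr d; lia.
Qed.

(** Along an edge from [x] to [y], a chain of [omega] starting at [x] yields
    one starting at [y]: drop its head if [y] comes next, and prepend [y]
    otherwise.  Connectedness does the rest. *)
Lemma omega_from x : exists c, omega c /\ c 0%N = x.
Proof.
have [base chain_base omegaE] := boundary.
have omega_base : omega base.
  by rewrite omegaE; split=> //; apply/chain_equivP; exists 0%N, 0%N.
have [s +] := adj_connected tree (base 0%N) x.
elim: s base omega_base {chain_base omegaE} => [|y s IH] c omega_c /=.
  by move=> _ <-; exists c.
case/andP=> adj_y path_s last_s; have chain_c := omega_chain omega_c.
have [eq_y|neq_y] := eqVneq y (c 1%N).
  apply: (IH (fun n => c (1 + n)%N)); rewrite -?eq_y//.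
  by apply: (omega_equiv (a := 1) (b := 0) omega_c).
apply: (IH (fun n => if n is n'.+1 then c n' else y)) => //.
apply: (omega_equiv (a := 0) (b := 1) omega_c) => //.
by apply: infinite_chain_cons => //; rewrite adj_symm.
Qed.

Lemma omega_uniq c d : omega c -> omega d -> c 0%N = d 0%N -> c = d.
Proof.
move=> omega_c omega_d eq0.
apply: (chain_equiv_inj adj_symm adj_irrefl (@adj_acyclic _ _ _ tree)) => //.
- exact: omega_chain.
- exact: omega_chain.
- exact/chain_equivP/omega_common_tail.
Qed.

Lemma ray_omega x : omega (ray omega x).
Proof. by have [] := xgetPex (fun=> x) (omega_from x). Qed.

Lemma ray0 x : ray omega x 0%N = x.
Proof. by have [] := xgetPex (fun=> x) (omega_from x). Qed.

Lemma ray_eq c : omega c -> ray omega (c 0%N) = c.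
Proof. by move=> omega_c; apply: omega_uniq; rewrite ?ray0//; exact: ray_omega. Qed.

Definition parent x := ray omega x 1%N.

Lemma rayE x n : ray omega x n = iter n parent x.
Proof.
elim: n => [|n IH]; first exact: ray0.
rewrite iterS -IH /parent.
have := @ray_eq (fun k => ray omega x (n + k)%N).
rewrite addn0 => ->; first by rewrite addn1.
apply: (omega_equiv (a := n) (b := 0) (ray_omega x)) => //.
exact/infinite_chain_shift/omega_chain/ray_omega.
Qed.

Lemma adj_parent x : adj x (parent x).
Proof. by have [] := omega_chain (ray_omega x) 0%N; rewrite ray0. Qed.

(** If [y] is a neighbour of [x] other than its parent, prepending [y] to the
    chain of [x] gives the chain of [y], so [x] is the parent of [y]. *)
Lemma adj_parentE x y : adj x y = (y == parent x) || (x == parent y).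
Proof.
apply/idP/idP => [adj_xy|]; last first.
  by case/orP=> /eqP ->; rewrite ?[adj _ y]adj_symm adj_parent.
have [//|neq_y] := eqVneq y (parent x); apply/eqP.
pose c n := if n is n'.+1 then ray omega x n' else y.
have omega_c : omega c.
  apply: (omega_equiv (a := 0) (b := 1) (ray_omega x)) => //.
  apply: infinite_chain_cons => //; first by rewrite ray0 adj_symm.
  exact/omega_chain/ray_omega.
by rewrite /parent (ray_eq omega_c) /= ray0.
Qed.

Lemma iter_parent_inj x : injective (fun n => iter n parent x).
Proof.
move=> m n; rewrite -!rayE.
exact/(infinite_chain_inj adj_irrefl (@adj_acyclic _ _ _ tree))/omega_chain/ray_omega.
Qed.

Lemma common_ancestor x y : exists m n, iter m parent x = iter n parent y.
Proof.
have [m [n eq_mn]] := omega_common_tail (ray_omega x) (ray_omega y).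
by exists m, n; rewrite -!rayE -[m]addn0 eq_mn addn0.
Qed.

(** The Busemann function of [omega] normalised at [base], which grows away
    from [omega].  Any pair of exponents leading [x] and [base] to a common
    ancestor gives the same difference, see [busemannE]. *)
Definition busemann base x : int :=
  let mn := xget (0, 0)%N
    [set mn : nat * nat | iter mn.1 parent x = iter mn.2 parent base] in
  mn.1%:Z - mn.2%:Z.

Lemma busemannE base x m n :
  iter m parent x = iter n parent base -> busemann base x = m%:Z - n%:Z.
Proof.
move=> eq_mn; rewrite /busemann.
case: xgetP => [[m' n'] _ /= eq_mn'|/(_ (m, n))]; last by [].
have : iter (m + n') parent x = iter (m' + n) parent x.
  rewrite [(m + n')%N]addnC [(m' + n)%N]addnC !iterD eq_mn eq_mn' -!iterD.
  by rewrite addnC.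
by move/iter_parent_inj; lia.
Qed.

Lemma busemann_iter base x n :
  busemann base (iter n parent x) = busemann base x - n%:Z.
Proof.
have [i [j eq_ij]] := common_ancestor x base.
rewrite (busemannE eq_ij) (@busemannE _ _ i (n + j)%N); first by lia.
by rewrite -iterD addnC iterD eq_ij -iterD.
Qed.

Lemma busemann_base base : busemann base base = 0.
Proof. by rewrite (@busemannE _ _ 0 0). Qed.

Lemma busemann_path base x s :
  path adj x s -> `|busemann base (last x s) - busemann base x| <= (size s)%:Z.
Proof.
elim: s x => [|y s IH] x /=; first by rewrite subrr.
rewrite adj_parentE => /andP[adj_xy /IH].
case/orP: adj_xy => /eqP ->; have := busemann_iter base _ 1; rewrite /= => ->; lia.
Qed.

(** Climbing to an ancestor is geodesic, because a Busemann function changes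
    by one along each edge. *)
Lemma dist_iter_parent x n : dist adj x (iter n parent x) = n.
Proof.
have walk_n : walk_length adj x (iter n parent x) n.
  exists (traject parent (parent x) n); split.
  - by apply: sub_path (fpath_traject _ _ _) => y z /eqP <-; exact: adj_parent.
  - by rewrite last_traject.
  - exact: size_traject.
apply: xget_unique.
  split=> // _ [s [path_s last_s <-]].
  by have := busemann_path x path_s; rewrite last_s busemann_iter; lia.
move=> m [[s [path_s last_s <-]] /(_ _ walk_n)].
by have := busemann_path x path_s; rewrite last_s busemann_iter; lia.
Qed.

Definition ancestors x := [set z | exists n, z = iter n parent x].

Lemma range_ray x : range (ray omega x) = ancestors x.
Proof.
apply/seteqP; split=> z /=.
  by case=> n _ <-; exists n; rewrite rayE.
by case=> n ->; exists n => //; rewrite rayE.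
Qed.

(** The lowest ancestor of [x] that is also an ancestor of [y] satisfies the
    condition defining the meet; this condition determines the meet through
    its set of ancestors. *)
Lemma ancestors_meet x y :
  ancestors (meet omega x y) = ancestors x `&` ancestors y.
Proof.
have ex_common : exists m, ancestors y (iter m parent x).
  by have [m [n eq_mn]] := common_ancestor x y; exists m, n.
pose P m := `[< ancestors y (iter m parent x) >].
have exP : exists m, P m by case: ex_common => m ym; exists m; exact/asboolP.
have [m0 /asboolP [n0 eq0] min_m0] := ex_minnP exP.
pose Q := [set z | range (ray omega x) `&` range (ray omega y)
                  = range (ray omega z)].
have : Q (meet omega x y).
  apply: xgetPex; exists (iter m0 parent x).
  rewrite /Q /= !range_ray; apply/seteqP; split=> z /=.
    case=> [[m zE] yz].
    have /min_m0 le_m : P m by apply/asboolP; rewrite -zE.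
    by exists (m - m0)%N; rewrite zE -iterD subnK.
  case=> k ->; split; first by exists (k + m0)%N; rewrite iterD.
  by rewrite eq0; exists (k + n0)%N; rewrite iterD.
by rewrite /Q /= !range_ray => ->.
Qed.

(** Both distances are climbs, so the value of the Busemann function at the
    meet cancels. *)
Lemma dist_meet base x y :
  (dist adj x (meet omega x y))%:Z - (dist adj y (meet omega x y))%:Z
  = busemann base x - busemann base y.
Proof.
have : ancestors (meet omega x y) (meet omega x y) by exists 0%N.
rewrite {1}ancestors_meet => -[[m eq_m] [n eq_n]].
rewrite {1}eq_m eq_n !dist_iter_parent.
have := busemann_iter base x m; rewrite -eq_m.
by have := busemann_iter base y n; rewrite -eq_n; lia.
Qed.

Lemma horo_indexE base x :
  horo_index adj omega [set y | same_horocycle adj omega base y] x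
  = busemann base x.
Proof.
have sameE y : same_horocycle adj omega base y <-> busemann base y = 0.
  have := dist_meet base base y; rewrite busemann_base /same_horocycle; lia.
apply: xget_unique => /= [|k].
  exists base; first exact/sameE/busemann_base.
  by have := dist_meet base x base; rewrite busemann_base; lia.
case=> y /sameE y0 eq_k; have := dist_meet base x y; lia.
Qed.

End Horofunction.

Lemma card_eq_setD1 (T : choiceType) (A : set T) (x : T) n :
  (A #= `I_n.+1)%card -> A x -> (A `\ x #= `I_n)%card.
Proof.
move=> cardA Ax; have finA : finite_set A by exists n.+1.
apply/fcard_eq; [exact: finite_setD | exact: finite_II |].
rewrite fset_setD1// [RHS](card_fset_set (card_eqxx _)).
have := cardfsD1 x (fset_set A).
by rewrite (card_fset_set cardA) in_fset_set// mem_set//; case.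
Qed.

Lemma card_children q (V : choiceType) (adj : rel V) (omega : set (nat -> V)) :
  homogeneous_tree q adj -> boundary_point adj omega ->
  forall z, ([set y | parent omega y = z] #= `I_q)%card.
Proof.
move=> tree boundary z.
suff -> : [set y | parent omega y = z] = [set y | adj z y] `\ parent omega z.
  by apply: card_eq_setD1 (adj_degree tree z) _; exact: (adj_parent tree boundary).
apply/seteqP; split=> y /=; rewrite (adj_parentE tree boundary).
  move=> <-; rewrite eqxx orbT; split=> // y_eq.
  by have /(_ 0%N 2%N y_eq) := @iter_parent_inj _ _ _ _ tree boundary y.
by case=> /orP[/eqP ->|/eqP ->].
Qed.

(** * Mass of the descendants of a vertex *)

Lemma esum_const (R : realType) (T : choiceType) (A : set T) n (a : R) :
  (A #= `I_n)%card -> 0 <= a ->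
  (\esum_(x in A) a%:E = (n%:R * a)%:E)%E.
Proof.
move=> cardA a_ge0; have finA : finite_set A by exists n.
rewrite esum_fset//; rewrite fsbig_finite//= sumEFin.
by rewrite big_const_seq count_predT (card_fset_set cardA) iter_addr addr0 mulr_natl.
Qed.

(** Summation fibre by fibre; applied to the map to the [n]-th ancestor, it
    splits the descendants of depth [n.+1] according to the child that they
    descend from. *)
Lemma esum_preimage (R : realType) (T I : choiceType) (A : set I) (g : T -> I)
    (a : T -> \bar R) : (forall x, 0 <= a x)%E ->
  (\esum_(x in g @^-1` A) a x
   = \esum_(i in A) \esum_(x in [set x | g x = i]) a x)%E.
Proof.
move=> a_ge0; rewrite esum_esum//.
rewrite (reindex_esum (g @^-1` A) _ (fun x => (g x, x)))//; split=> //=.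
- by move=> x y _ _ /(congr1 snd).
- by move=> [i x] [/= Ai gx]; exists x; rewrite /= gx.
Qed.

Section SubtreeMass.
Variables (R : realType) (V : choiceType) (q : nat) (s : R).
Variables (par : V -> V) (h : V -> int) (w : V -> R).
Hypothesis card_par : forall z, ([set y | par y = z] #= `I_q)%card.
Hypothesis h_par : forall x, h (par x) = h x - 1.
Hypothesis w_par : forall x, w x = s * w (par x).
Hypothesis w_ge0 : forall x, 0 <= w x.
Hypothesis s_ge0 : 0 <= s.
Hypothesis qs_lt1 : q%:R * s < 1.

(** Each generation has [q] times as many vertices as the preceding one, each
    of them with [s] times the weight. *)
Lemma esum_generation n z :
  (\esum_(y in [set y | iter n par y = z]) (w y)%:E
   = ((q%:R * s) ^+ n * w z)%:E)%E.
Proof.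
elim: n z => [|n IH] z.
  by rewrite expr0 mul1r (_ : [set y | _] = [set z]) ?esum_set1 ?lee_fin//.
rewrite (esum_preimage [set x | par x = z] (iter n par)); last first.
  by move=> x; rewrite lee_fin.
rewrite (eq_esum (b := fun=> ((q%:R * s) ^+ n * (s * w z))%:E)); last first.
  by move=> x /= <-; rewrite IH -w_par.
rewrite (esum_const (card_par z)); first by congr EFin; rewrite exprSr; lra.
by rewrite !mulr_ge0// exprn_ge0// mulr_ge0.
Qed.

Definition subtree z := [set y | exists n, iter n par y = z].

Lemma h_iter n x : h (iter n par x) = h x - n%:Z.
Proof. by elim: n => [|n IH] /=; rewrite ?h_par ?IH; lia. Qed.

Lemma esum_subtree z :
  (\esum_(y in subtree z) (w y)%:E = (w z / (1 - q%:R * s))%:E)%E.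
Proof.
have -> : subtree z = \bigcup_n [set y | iter n par y = z].
  by apply/seteqP; split=> y /= [n]; exists n.
rewrite nneseries_sum_bigcup; first last.
- by move=> x; rewrite lee_fin.
- move=> m n _ _ [y [/= eq_m eq_n]].
  by have := h_iter m y; have := h_iter n y; rewrite eq_m eq_n; lia.
under eq_eseriesr do rewrite esum_generation.
apply: cvg_lim => //.
have qs_ge0 : 0 <= q%:R * s by rewrite mulr_ge0.
apply: cvg_EFin; first by apply: nearW => n; rewrite sumEFin.
rewrite (_ : fine \o _ = series (geometric (w z) (q%:R * s))); last first.
  apply/funext => n; rewrite /= sumEFin/= /series/=.
  by apply: eq_bigr => i _; rewrite mulrC.
by apply: cvg_geometric_series; rewrite ger0_norm.
Qed.

End SubtreeMass.

(** * Balls of the horocyclic Gromov distance *)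

Section Balls.
Variables (R : realType) (q : nat) (V : choiceType) (adj : rel V).
Variables (omega : set (nat -> V)) (H0 : set V).
Hypothesis tree : homogeneous_tree q adj.
Hypothesis boundary : boundary_point adj omega.
Hypothesis horoH0 : is_horocycle adj omega H0.

Local Notation par := (parent omega).
Local Notation h := (horo_index adj omega H0).

Lemma horo_index_iter n x : h (iter n par x) = h x - n%:Z.
Proof.
have [base ->] := horoH0.
by rewrite !(horo_indexE tree boundary) (busemann_iter tree boundary).
Qed.

(** Since [h] drops by one at each step to the parent, it is largest on a set
    of ancestors at the lowest one.  So [n <= h (meet omega x y)] says that the
    ancestor of [x] at level [n] is an ancestor of [y] too, and it forces
    [n <= h x]. *)
Lemma closed_ball_horo_rho (x : V) (r : R) : 0 < r ->
  let n := Num.ceil (- ln r) in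
  closed_ball_of (@horo_rho R V adj omega H0) x r =
  if h x < n then [set x] else subtree par (iter `|h x - n|%N par x).
Proof.
move=> r_gt0 n.
have rhoE y : horo_rho R adj omega H0 x y <= r <->
    x = y \/ n <= h (meet omega x y).
  rewrite /horo_rho; case: eqVneq => [->|neq_xy].
    by split=> [_|_]; [left | exact: ltW].
  rewrite -[X in _ <= X](lnK (x := r)) ?posrE// ler_expR lerNl -ceil_le_int.
  by split=> [|[/eqP|//]]; [right | rewrite (negbTE neq_xy)].
have meet_anc y : ancestors omega x (meet omega x y) /\
    ancestors omega y (meet omega x y).
  change ((ancestors omega x `&` ancestors omega y) (meet omega x y)).
  by rewrite -(ancestors_meet tree boundary); exists 0%N.
apply/seteqP; split=> y.
  move=> /rhoE [<-|le_n]; case: ltP => [lt_hx|ge_hx] //.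
  - by exists `|h x - n|%N.
  - by have [[k eq_k] _] := meet_anc y; move: le_n; rewrite eq_k horo_index_iter; lia.
  - have [[k eq_k] [l eq_l]] := meet_anc y.
    move: le_n; rewrite {1}eq_k horo_index_iter => le_n.
    exists (`|h x - n| - k + l)%N.
    rewrite iterD -eq_l eq_k -iterD; congr iter; lia.
case: ltP => [_ ->|ge_hx [k eq_k]]; first by apply/rhoE; left.
apply/rhoE; right; set z := iter `|h x - n|%N par x in eq_k.
have hz : h z = n by rewrite horo_index_iter; lia.
have : ancestors omega (meet omega x y) z.
  by rewrite (ancestors_meet tree boundary); split; [exists `|h x - n|%N | exists k].
by case=> j z_eq; move: hz; rewrite z_eq horo_index_iter; lia.
Qed.

End Balls.

(** It is enough that [0 <= ln 2 <= 1], the upper bound being [2 <= e]. *)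
Lemma ceil_ln_double (R : realType) (r : R) : 0 < r ->
  Num.ceil (- ln (2 * r)) <= Num.ceil (- ln r) <= Num.ceil (- ln (2 * r)) + 1.
Proof.
move=> r_gt0; rewrite lnM ?posrE//.
have ln2_ge0 : 0 <= ln 2 :> R by rewrite ln_ge0// ler1n.
have ln2_le1 : ln 2 <= 1 :> R.
  rewrite -ler_expR lnK ?posrE//.
  by apply: le_trans (expR_ge1Dx 1).
apply/andP; split; first by apply: le_ceil; lra.
rewrite ceil_le_int intrD.
by have := ceil_ge (- (ln 2 + ln r)); lra.
Qed.

Theorem proposition6 (R : realType) (q : nat) (V : pointedType) (adj : rel V)
    (omega : set (nat -> V)) (H0 : set V) (alpha : R) :
  (2 <= q)%N ->
  homogeneous_tree q adj ->
  boundary_point adj omega ->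
  is_horocycle adj omega H0 ->
  1 < alpha ->
  @doubling_constant R _ (discrete V)
    (@horo_rho R V adj omega H0) (@sigma R q V adj omega H0 alpha)
    (k_const q alpha).
Proof.
move=> q_ge2 tree boundary horoH0 alpha_gt1.
have q_gt0 : 0 < q%:R :> R by rewrite ltr0n; lia.
have q_neq0 : q%:R != 0 :> R by rewrite gt_eqF.
have lnq_gt0 : 0 < ln q%:R :> R by rewrite ln_gt0// ltr1n.
pose s : R := q%:R `^ (- alpha).
have s_gt0 : 0 < s by rewrite powR_gt0.
have qsE : q%:R `^ (1 - alpha) = q%:R * s.
  by rewrite powRD ?q_neq0 ?implybT// powRr1 ?ltW.
have qs_lt1 : q%:R * s < 1.
  by rewrite -qsE /powR (negbTE q_neq0) expR_lt1 pmulr_llt0// subr_lt0.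
have s_inv : q%:R `^ alpha = s^-1 by rewrite -powRN opprK.
have s_lt1 : s < 1.
  by rewrite /s /powR (negbTE q_neq0) expR_lt1 pmulr_llt0// oppr_lt0; lra.
pose par := parent omega.
pose h := horo_index adj omega H0.
pose w := sigma_weight q adj omega H0 alpha.
have h_par x : h (par x) = h x - 1.
  exact: (horo_index_iter tree boundary horoH0 1).
have w_gt0 x : 0 < w x by rewrite powR_gt0.
have w_par x : w x = s * w (par x).
  rewrite /w /sigma_weight -/h h_par -powRD ?q_neq0 ?implybT//.
  by congr powR; rewrite intrB; lra.
pose mass := esum_subtree (card_children tree boundary) h_par w_par
  (fun x => ltW (w_gt0 x)) (ltW s_gt0) qs_lt1.
have qs1_gt0 : 0 < 1 - q%:R * s by rewrite subr_gt0.
rewrite /k_const qsE s_inv; set k := Num.max _ _.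
have k_ge_sV : s^-1 <= k by rewrite le_max lexx.
have k_ge_mass : (1 - q%:R * s)^-1 <= k by rewrite le_max lexx orbT.
have k_ge1 : 1 <= k by apply: le_trans k_ge_sV; rewrite invf_ge1// ltW.
split=> [|x r r_gt0]; first exact: lt_le_trans k_ge1.
have /andP[] := ceil_ln_double r_gt0.
rewrite !(closed_ball_horo_rho tree boundary horoH0)//=; last by lra.
set n := Num.ceil (- ln r); set n' := Num.ceil (- ln (2 * r)) => le_n' le_n.
rewrite -/h -/par /sigma.
have [lt_n'|ge_n'] := ltP (h x) n'.
  (* Both balls are reduced to their centre. *)
  have -> : h x < n by lia.
  by rewrite lee_pemull ?lee_fin// esum_ge0// => y _; rewrite lee_fin ltW.
have [lt_n|ge_n] := ltP (h x) n.
  (* Here [h x = n'], so the larger ball consists of the descendants of [x]. *)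
  have -> : `|h x - n'|%N = 0%N by lia.
  rewrite mass esum_set1 ?lee_fin ?powR_ge0// mulrC.
  by rewrite ler_wpM2r ?powR_ge0.
have [->|neq_n] := eqVneq n' n.
  by rewrite lee_pemull ?lee_fin// esum_ge0// => y _; rewrite lee_fin ltW.
(* Now [n = n' + 1]: doubling passes from the descendants of [z] to those of
   its parent. *)
have -> : `|h x - n'|%N = `|h x - n|%N.+1 by lia.
set z := iter `|h x - n| par x; rewrite iterS -/z !mass -EFinM lee_fin.
rewrite mulrA ler_wpM2r ?invr_ge0 ?(ltW qs1_gt0)//.
by rewrite [w z]w_par mulrA ler_peMl ?powR_ge0// -ler_pdivrMr// mul1r.
Qed.
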